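(* Let $(X,d)$ and $(Y,e)$ be metric spaces, let $D\subseteq X$, and let $\theta:D\to Y$. Let $A$ and $B$ be dense subsets of $(X,d)$ and $(Y,e)$, respectively. Then an $A,B$-approximation system for $\theta$ exists if and only if $\theta$ is continuous. Moreover, if $\theta$ is continuous, then the set of all $(a,m,b,n)\in A\times\mathbb{N}\times B\times\mathbb{N}$ satisfying $$\forall\xi\in D\left(d(a,\xi)<\tfrac{1}{m+1}\Rightarrow e(b,\theta(\xi))<\tfrac{1}{n+1}\right)$$ is an $A,B$-approximation system for $\theta$.
   Context: Here $\mathbb{N}=\{0,1,2,\dots\}$. Given metric spaces $(X,d)$, $(Y,e)$, a function $\theta:D\to Y$ with $D\subseteq X$, and dense subsets $A\subseteq X$, $B\subseteq Y$, a subset $S\subseteq A\times\mathbb{N}\times B\times\mathbb{N}$ is called an $A,B$-approximation system for $\theta$ if for every $\xi\in D$ the following two conditions hold: (1) whenever $(a,m,b,n)\in S$ and $d(a,\xi)<\frac{1}{m+1}$, then $e(b,\theta(\xi))<\frac{1}{n+1}$; (2) for every $n\in\mathbb{N}$ there exists $m\in\mathbb{N}$ such that for every $a\in A$ with $d(a,\xi)<\frac{1}{m+1}$ there is some $b$ with $(a,m,b,n)\in S$. Continuity of $\theta$ means continuity as a map from the subspace $D$ of $(X,d)$ to $(Y,e)$. *)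

(* Defs.v *)
From mathcomp Require Import all_boot all_order all_algebra.
From mathcomp Require Import all_classical all_reals topology.

Set Implicit Arguments.
Unset Strict Implicit.
Unset Printing Implicit Defensive.

Import Order.TTheory GRing.Theory Num.Theory.

Local Open Scope classical_set_scope.
Local Open Scope ring_scope.

(* A function defined only on D is a function on the subtype [set_type D]
   (inserted by coercion), whose canonical topology is the one induced by the
   inclusion [\val] into X. *)
Definition approximation_system (R : realType) (X Y : metricType R)
    (D : set X) (theta : D -> Y) (A : set X) (B : set Y)
    (S : set (X * nat * Y * nat)) : Prop :=
  S `<=` A `*` [set: nat] `*` B `*` [set: nat] /\
  forall xi : D,
    (forall a m b n, S (a, m, b, n) ->
       mdist a (\val xi) < 1 / m.+1%:R -> mdist b (theta xi) < 1 / n.+1%:R) /\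
    (forall n : nat, exists m : nat, forall a, A a ->
       mdist a (\val xi) < 1 / m.+1%:R -> exists b, S (a, m, b, n)).

(* Main.v *)
(** Both directions rest on the usual epsilon-delta estimate, with radii of the
    form 1/(n+1).  Given a system, pick [a] in [A] close to [xi] and [b] with
    [(a, m, b, n)] in the system: condition (1) places [theta xi], as well as
    [theta eta] for all [eta] near [xi], within 1/(n+1) of the same [b].
    Conversely, for continuous [theta], pick [b] in [B] close to [theta xi]; the
    ball of radius 1/(m+1) around any [a] close to [xi] has diameter less than
    2/(m+1), so [theta] maps it into a small ball around [b]. *)
Require Import Defs.
From mathcomp Require Import all_boot all_order all_algebra.
From mathcomp Require Import all_classical all_reals topology.

Import Order.TTheory GRing.Theory Num.Theory.

Local Open Scope classical_set_scope.
Local Open Scope ring_scope.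

Lemma inv_succ_lt (R : realType) (e : R) :
  0 < e -> exists n : nat, 1 / n.+1%:R < e.
Proof. by move=> /ltr_add_invr[n]; rewrite add0r => ne; exists n; rewrite div1r. Qed.

Lemma inv_succ_gt0 (R : realType) (n : nat) : 0 < 1 / n.+1%:R :> R.
Proof. by rewrite divr_gt0. Qed.

Lemma mdist_triangle_lt (R : realType) (X : metricType R) (x y z : X) (d e : R) :
  mdist x y < d -> mdist y z < e -> mdist x z < d + e.
Proof. by move=> xy yz; apply: le_lt_trans (metric_triangle _ y _) (ltrD xy yz). Qed.

Lemma dense_mdist (R : realType) (X : metricType R) (A : set X) (x : X) (e : R) :
  dense A -> 0 < e -> exists2 a, A a & mdist a x < e.
Proof.
move=> dA e0.
have xe : nbhs x (ball x e) by exact: nbhsx_ballx.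
(* [dense] only speaks of nonempty open sets, hence the interior of the ball, which contains [x]. *)
have [||a [/interior_subset + Aa]] := dA (ball x e)^°.
- by exists x.
- exact: open_interior.
by rewrite ballEmdist /= metric_sym => ?; exists a.
Qed.

(** The balls of the subtype [D] are the preimages under [\val] of balls of [X]
    ([initial_ballE]). *)
Lemma continuous_set_typeP (R : realType) (X Y : metricType R) (D : set X)
    (theta : D -> Y) :
  continuous theta <->
  forall (xi : D) (e : R), 0 < e -> exists2 d, 0 < d & forall eta : D,
    mdist (\val xi) (\val eta) < d -> mdist (theta xi) (theta eta) < e.
Proof.
split=> [cth xi e e0|cth xi].
- have := cth xi (ball (theta xi) e) (nbhsx_ballx _ _ e0).
  rewrite -nbhs_ballE => -[d /= d0 sub]; exists d => // eta xieta.
  have : ball (theta xi) e (theta eta).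
    by apply: sub; rewrite -initial_ballE /= ballEmdist.
  by rewrite ballEmdist.
- apply/(@metricType_numDomainType.cvgrPdist_lt _ _ _ _ (nbhs_filter xi)) => e /(cth xi)[d d0 sub].
  apply: filterS (nbhsx_ballx xi d d0) => eta.
  by rewrite -initial_ballE /= ballEmdist; exact: sub.
Qed.

Lemma approximation_system_continuous (R : realType) (X Y : metricType R)
    (D : set X) (theta : D -> Y) (A : set X) (B : set Y)
    (S : set (X * nat * Y * nat)) :
  dense A -> approximation_system theta A B S -> continuous theta.
Proof.
move=> dA [_ SP]; apply/continuous_set_typeP => xi e e0.
have [n ne] := inv_succ_lt _ _ (divr_gt0 e0 (ltr0n R 2)).
have [m /(_ _)aS] := (SP xi).2 n.
have [a Aa axi] := dense_mdist _ _ _ (\val xi) _ dA (inv_succ_gt0 R m).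
have [b Sb] := aS _ Aa axi.
(* This radius is the slack of [xi] in the ball around [a]: every [eta] within it of [xi] still lies
   in that ball, so the same [(a, m, b, n)] applies to [eta]. *)
exists (1 / m.+1%:R - mdist a (\val xi)); first by rewrite subr_gt0.
move=> eta xieta.
have aeta : mdist a (\val eta) < 1 / m.+1%:R.
  by rewrite (le_lt_trans (metric_triangle _ (\val xi) _)) // -ltrBrDl.
have bxi := (SP xi).1 _ _ _ _ Sb axi.
have beta := (SP eta).1 _ _ _ _ Sb aeta.
rewrite [e]splitr; apply: (mdist_triangle_lt _ _ _ b).
  by rewrite metric_sym (lt_trans bxi).
exact: lt_trans beta ne.
Qed.

Lemma continuous_approximation_system (R : realType) (X Y : metricType R)
    (D : set X) (theta : D -> Y) (A : set X) (B : set Y) :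
  dense B -> continuous theta ->
  approximation_system theta A B
    [set s : X * nat * Y * nat | let: (a, m, b, n) := s in
       [/\ A a, B b & forall xi : D,
          mdist a (\val xi) < 1 / m.+1%:R ->
          mdist b (theta xi) < 1 / n.+1%:R]].
Proof.
move=> dB /continuous_set_typeP cth; split=> [[[[a m] b] n] [Aa Bb _] //|xi].
split=> [a m b n [_ _]|n]; first exact.
(* One half bounds the distance from [b] to [theta xi], the other that from [theta xi] to
   [theta eta]. *)
have n0 : 0 < 1 / n.+1%:R / 2 :> R by rewrite divr_gt0 ?inv_succ_gt0.
have [d d0 thd] := cth xi _ n0.
have [m md] := inv_succ_lt _ _ (divr_gt0 d0 (ltr0n R 2)).
exists m => a Aa axi.
have [b Bb bxi] := dense_mdist _ _ _ (theta xi) _ dB n0.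
(* Although [b] was chosen from [xi], membership requires the estimate at every [eta] in [D] near
   [a]; such an [eta] is within [d] of [xi], via [a]. *)
exists b; split=> // eta aeta.
rewrite [X in _ < X]splitr; apply: (mdist_triangle_lt _ _ _ _ _ _ _ bxi).
apply: thd; rewrite [d]splitr; apply: (mdist_triangle_lt _ _ _ a).
  by rewrite metric_sym (lt_trans axi).
exact: lt_trans aeta md.
Qed.

Theorem theorem1 (R : realType) (X Y : metricType R) (D : set X)
    (theta : D -> Y) (A : set X) (B : set Y) (hA : dense A) (hB : dense B) :
  ((exists S : set (X * nat * Y * nat), approximation_system theta A B S)
     <-> continuous theta) /\
  (continuous theta ->
     approximation_system theta A B
       [set s : X * nat * Y * nat | let: (a, m, b, n) := s in
          [/\ A a, B b & forall xi : D,
             mdist a (\val xi) < 1 / m.+1%:R ->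
             mdist b (theta xi) < 1 / n.+1%:R]]).
Proof.
split; last exact: continuous_approximation_system.
split=> [[S]|cth]; first exact: approximation_system_continuous.
by eexists; exact: (continuous_approximation_system _ _ _ _ _ _ _ hB cth).
Qed.
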